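(* Consider $X=\mathbb{C}/\!\!/\mathbb{C}^*=[(\mathbb{C}\setminus0)/\mathbb{C}^*]$, where the $\mathbb{C}^*$-action is the standard action by multiplication. The $\mathbb{C}^*$-equivariant $K$-ring $K_{\mathbb{C}^*}(X)$ is isomorphic to the representation ring $\mathrm{Repr}(\mathbb{C}^* )$. Let $\lambda\in K_{\mathbb{C}^*}(X)$ be the equivariant parameter corresponding to the standard representation. For the $\mathbb{C}^*$-representations $\mathrm{St}$ and $\mathrm{St}^\vee$, the equivariant small $I$-functions of level $l$ are given explicitly by $$I^{\mathrm{St},l}_X(q,Q)=1+\sum_{n\ge1}\frac{q^{\frac{n(n-1)l}{2}}}{(1-\lambda^{-1}q)(1-\lambda^{-1}q^2)\cdots(1-\lambda^{-1}q^n)}Q^n,$$ $$I^{\mathrm{St}^\vee,l}_X(q,Q)=1+\sum_{n\ge1}\frac{q^{\frac{n(n+1)l}{2}}}{(1-\lambda^{-1}q)(1-\lambda^{-1}q^2)\cdots(1-\lambda^{-1}q^n)}Q^n.$$ By choosing certain specializations of the parameters, one obtains Ramanujan's mock theta functions of order 3: $$I^{\mathrm{St},l=1}_X(q^2,Q)|_{\lambda=-1,Q=q}=1+\sum_{n\ge1}\frac{q^{n^2}}{(1+q^2)(1+q^4)\cdots(1+q^{2n})},$$ $$I^{\mathrm{St},l=1}_X(q^2,Q)|_{\lambda=q,Q=q}=1+\sum_{n\ge1}\frac{q^{n^2}}{(1-q)(1-q^3)\cdots(1-q^{2n-1})},$$ $$I^{\mathrm{St},l=1}_X(q^2,Q)|_{\lambda=-q,Q=1}=1+\sum_{n\ge1}\frac{q^{n(n-1)}}{(1+q)(1+q^3)\cdots(1+q^{2n-1})},$$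 and Ramanujan's mock theta functions of order 5: $$I^{\mathrm{St},l=2}_X(q,Q)|_{\lambda=-1,Q=q}=1+\sum_{n\ge1}\frac{q^{n^2}}{(1+q)(1+q^2)\cdots(1+q^n)},$$ $$I^{\mathrm{St},l=2}_X(q^2,Q)|_{\lambda=q,Q=q^2}=1+\sum_{n\ge1}\frac{q^{2n^2}}{(1-q)(1-q^3)\cdots(1-q^{2n-1})},$$ $$I^{\mathrm{St}^\vee,l=2}_X(q,Q)|_{\lambda=-1,Q=1}=1+\sum_{n\ge1}\frac{q^{n(n+1)}}{(1+q)(1+q^2)\cdots(1+q^n)},$$ $$I^{\mathrm{St}^\vee,l=2}_X(q^2,Q)|_{\lambda=q,Q=1}=1+\sum_{n\ge1}\frac{q^{2n^2+2n}}{(1-q)(1-q^3)\cdots(1-q^{2n-1})}.$$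
   Context: $\mathrm{St}$ is the standard representation of $G=\mathbb{C}^*$ and $\mathrm{St}^\vee$ its dual; $Q$ is the Novikov variable. $I(q^2,Q)$ means $I(q,Q)$ with $q$ replaced by $q^2$ ($Q$ unchanged), and $|_{\lambda=\cdot,Q=\cdot}$ denotes substitution in the displayed formula. Equivariant small $I$-function. For $n\ge1$ consider the quasimap graph space of class $n$ for $X$: principal $G$-bundles on the parametrized $\mathbb{P}^1$ together with a section, not identically zero, of the degree-$n$ line bundle $\mathcal{O}_{\mathbb{P}^1}(n)$. $\mathbb{C}^*$ acts on it through $t\cdot[x_0,x_1]=[tx_0,x_1]$ on $\mathbb{P}^1$; let $0=[1,0]$ and let $F_n$ be the component of the fixed locus consisting of quasimaps whose only base point, carrying all the degree, is at $0$, with $\mathrm{ev}:F_n\to X$ the generic value. Let $N$ be its virtual normal bundle and $\mathcal{O}^{\mathrm{vir}}_{F_n}$ its virtual structure sheaf. For a representation $R$ of $G$ let $\mathcal{D}^{R,l}=(\det R\pi_*(\mathcal{P}\times_GR))^{-l}$ be the level-$l$ determinant line bundle, with $\mathcal{P}$ the universal $G$-bundle on the universal curve and $\pi$ the projection of the universal curve. (Sign convention: the line bundle associated with the character through which $G$ acts on the coordinate $z$ of $\mathbb{C}$ is $\mathcal{O}(-D)$, $D=\{z=0\}$; thus the line bundle associated with $\mathrm{St}$ has degree $-n$ in class $n$, and the one associated with $\mathrm{St}^\vee$ has degree $n$.) Write $\mathrm{tr}_{\mathbb{C}^*}(V)=\sum_iq^iV(i)$ with $V(i)$ the weight-$i$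 part, and $\wedge^*N^\vee=\sum_i(-1)^i\wedge^iN^\vee$. Then $$I^{R,l}_X(q,Q)=1+\sum_a\sum_{n\ge1}Q^n\,\chi\Big(F_n,\mathcal{O}^{\mathrm{vir}}_{F_n}\otimes\mathrm{ev}^*\phi_a\otimes\frac{\mathrm{tr}_{\mathbb{C}^*}\mathcal{D}^{R,l}}{\mathrm{tr}_{\mathbb{C}^*}\wedge^*N^\vee}\Big)\phi^a,$$ where $\{\phi_a\},\{\phi^a\}$ are bases of the equivariant $K$-group of $X$ dual with respect to $\chi(u\otimes v\otimes(\det\mathcal{R})^{-l})$, $\mathcal{R}$ is the bundle on $X$ associated with $R$, and all Euler characteristics are equivariant for the standard torus action on $X$.
   Formalization: The universal bundle over F_n is given trivial torus weight (class 1) and the torus acts only by scaling the coordinate z by λ; with the invariant universal section λ would cancel from N and the displayed formulas would fail. *)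

(* Defs.v *)
From HB Require Import structures.
From mathcomp Require Import all_boot all_order all_algebra.
From mathcomp Require Import complex mxtens zify.
From mathcomp Require Import all_classical all_reals all_analysis.
Import numFieldNormedType.Exports.
Import Order.TTheory GRing.Theory Num.Theory.

Set Implicit Arguments.
Unset Strict Implicit.
Unset Printing Implicit Defensive.

Local Open Scope ring_scope.
Local Open Scope classical_set_scope.

(* Z[lam^+-1, q^+-1] is the character ring of C^* x T, where C^* acts on P^1
   and T = C^* acts on X; K-theoretic localization happens in its fraction
   field, realised as Frac(Z[lam][q]). *)
Definition Kloc := {fraction {poly {poly int}}}.
Definition qK : Kloc := tofrac 'X.
Definition lamK : Kloc := tofrac 'X%:P.

(* Repr(T) = Z[lam^+-1], each class being identified with its character. *)
Definition ReprT (x : Kloc) : Prop :=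
  exists (N : nat) (p : {poly int}), lamK ^+ N * x = tofrac p%:P.

Section EquivariantBundles.
Variable R : realType.
Local Notation C := (complex R).

(* Functions on a power of the torus C^* given by Laurent polynomials. *)
Definition laurent1 (f : C -> C) : Prop :=
  exists (N : nat) (p : {poly C}), forall z, z != 0 -> z ^+ N * f z = p.[z].

Definition laurent3 (f : C -> C -> C -> C) : Prop :=
  exists (N : nat) (p : {poly {poly {poly C}}}),
    forall g t z, g != 0 -> t != 0 -> z != 0 ->
      (g * t * z) ^+ N * f g t z = p.[z%:P%:P].[t%:P].[g].

(* A T-equivariant vector bundle on X is a (G x T)-equivariant one on C \ 0,
   where both groups act by multiplication on the coordinate z.  C[z, 1/z]
   being a PID, the underlying bundle is trivial and the equivariant structure
   is a cocycle: (g, t) sends v in the fibre over z to v *m A g t z in the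
   fibre over g t z.  Only the values at nonzero arguments matter. *)
Definition cocycle (r : nat) := C -> C -> C -> 'M[C]_r.

Definition eq_bundle r (A : cocycle r) : Prop :=
  [/\ forall i j, laurent3 (fun g t z => A g t z i j),
      forall z, z != 0 -> A 1 1 z = 1%:M
    & forall g t g' t' z,
        g != 0 -> t != 0 -> g' != 0 -> t' != 0 -> z != 0 ->
        A (g * g') (t * t') z = A g' t' z *m A g t (g' * t' * z)].

Definition bundle_map r s (A : cocycle r) (B : cocycle s)
    (f : C -> 'M[C]_(r, s)) : Prop :=
  (forall i j, laurent1 (fun z => f z i j)) /\
  (forall g t z, g != 0 -> t != 0 -> z != 0 ->
     A g t z *m f (g * t * z) = f z *m B g t z).

Definition short_exact r' r r'' (A' : cocycle r') (A : cocycle r)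
    (A'' : cocycle r'') : Prop :=
  exists (f : C -> 'M[C]_(r', r)) (h : C -> 'M[C]_(r, r'')),
    [/\ bundle_map A' A f, bundle_map A A'' h
      & forall z, z != 0 ->
          [/\ row_free (f z), (f z :=: kermx (h z))%MS & row_full (h z)]].

Definition additive_invariant (V : zmodType)
    (f : forall r, cocycle r -> V) : Prop :=
  forall r' r r'' (A' : cocycle r') (A : cocycle r) (A'' : cocycle r''),
    eq_bundle A' -> eq_bundle A -> eq_bundle A'' -> short_exact A' A A'' ->
    f r A = f r' A' + f r'' A''.

Definition tens_bundle r s (A : cocycle r) (B : cocycle s) : cocycle (r * s) :=
  fun g t z => A g t z *t B g t z.

Definition trivial_bundle : cocycle 1 := fun _ _ _ => 1%:M.

(* Pullback to X of the standard representation of T. *)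
Definition std_bundle : cocycle 1 := fun _ t _ => t%:M.

(* [ch] induces a ring isomorphism from K_T(X), the Grothendieck ring of
   equivariant bundles, onto Repr(T), and maps the standard representation to
   lam.  By the universal property of the Grothendieck group, [A] = [B] in
   K_T(X) means that all additive invariants agree on A and B. *)
Definition K_iso (ch : forall r, cocycle r -> Kloc) : Prop :=
  [/\ additive_invariant ch,
      forall r s (A : cocycle r) (B : cocycle s), eq_bundle A -> eq_bundle B ->
        ch (r * s)%N (tens_bundle A B) = ch r A * ch s B,
      ch 1%N trivial_bundle = 1,
      forall r s (A : cocycle r) (B : cocycle s), eq_bundle A -> eq_bundle B ->
        ch r A = ch s B ->
        forall (V : zmodType) (f : forall r, cocycle r -> V),
          additive_invariant f -> f r A = f s B
    & [/\ forall r (A : cocycle r), eq_bundle A -> ReprT (ch r A),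
          forall x, ReprT x ->
            exists r s (A : cocycle r) (B : cocycle s),
              [/\ eq_bundle A, eq_bundle B & x = ch r A - ch s B]
        & ch 1%N std_bundle = lamK]].

End EquivariantBundles.

(* A finite-dimensional representation is the list of its weights (i, j),
   standing for the character q^i lam^j; a virtual one is a formal difference
   V.1 - V.2. *)
Definition rep := seq (int * int).
Definition vrep := (rep * rep)%type.

Definition wtK (w : int * int) : Kloc := qK ^ w.1 * lamK ^ w.2.

Definition dual_rep (V : rep) : rep := [seq (- w.1, - w.2) | w <- V].

Definition tens_char (c : int * int) (V : rep) : rep :=
  [seq (c.1 + w.1, c.2 + w.2) | w <- V].

Definition fixed_part (V : rep) : rep := [seq w <- V | w.1 == 0].
Definition moving_part (V : rep) : rep := [seq w <- V | w.1 != 0].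

Definition tr_det (V : rep) : Kloc := \prod_(w <- V) wtK w.

Definition tr_wedge (k : nat) (V : rep) : Kloc :=
  \sum_(A : {set 'I_(size V)} | #|A| == k) \prod_(i in A) wtK (nth (0, 0) V i).

Definition tr_lambda (V : rep) : Kloc :=
  \sum_(0 <= k < (size V).+1) (-1) ^+ k * tr_wedge k V.

Definition vtr_det (V : vrep) : Kloc := tr_det V.1 / tr_det V.2.

Definition vtr_lambda_dual (V : vrep) : Kloc :=
  tr_lambda (dual_rep V.1) / tr_lambda (dual_rep V.2).

Section Quasimaps.
Variable R : realType.
Local Notation C := (complex R).

(* A principal G-bundle of class n is that of L = O(n), unique up to
   isomorphism and with automorphism group C^*; a section is a binary form
   \sum_a s_a x0^a x1^(n-a). *)
Definition form (n : nat) := 'rV[C]_n.+1.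

Definition is_quasimap n (s : form n) : Prop := s != 0.

Definition qm_iso n (s s' : form n) : Prop := exists2 c : C, c != 0 & s' = c *: s.

(* (t . s)(x0, x1) = s(x0 / t, x1) *)
Definition act n (t : C) (s : form n) : form n :=
  \row_a (t ^- a * s ord0 a).

(* s in the local coordinate x1 / x0 at the point 0 = [1, 0] *)
Definition local_eq n (s : form n) : {poly C} :=
  \sum_(a < n.+1) s ord0 a *: 'X^(n - a).

(* As the zeros of s have total multiplicity n, multiplicity n at 0 means that
   0 is the only base point. *)
Definition in_F n (s : form n) : Prop :=
  [/\ is_quasimap s, forall t : C, t != 0 -> qm_iso s (act t s)
    & mup 0 (local_eq s) = n].

Definition x1_pow n : form n := delta_mx ord0 ord0.

(* A point s of F_n and the weight k with t . s = t^k s; dividing the action on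
   L by t^k makes s invariant, which is the C^*-linearization of the universal
   bundle at that point of F_n. *)
Definition F_point n : form n := xget 0 [set s : form n | in_F s].

Definition F_weight n : int :=
  xget 0 [set k : int | forall t : C, t != 0 ->
                          act t (F_point n) = t ^ k *: F_point n].

Lemma local_eq_x1 n : local_eq (x1_pow n) = 'X^n.
Proof.
rewrite /local_eq big_ord_recl /= subn0 big1 => [|i _].
  by rewrite mxE !eqxx scale1r addr0.
by rewrite mxE /= scale0r.
Qed.

Lemma act_x1 n (t : C) : act t (x1_pow n) = x1_pow n.
Proof.
apply/rowP => a; rewrite !mxE /=.
by case: eqVneq => [->|_]; rewrite ?mulr0 // expr0 invr1 mul1r.
Qed.

Lemma local_eqZ n c (s : form n) : local_eq (c *: s) = c *: local_eq s.
Proof.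
by rewrite /local_eq scaler_sumr; apply: eq_bigr => a _; rewrite mxE scalerA.
Qed.

Lemma coef_local_eq n (s : form n) (a : 'I_n.+1) :
  (local_eq s)`_(n - a) = s ord0 a.
Proof.
rewrite /local_eq coef_sum (bigD1 a) //= coefZ coefXn eqxx mulr1.
rewrite big1 ?addr0 // => b neq; rewrite coefZ coefXn.
case: eqP => [e|_]; last by rewrite mulr0.
case/negP: neq; apply/eqP/val_inj => /=.
have := ltn_ord a; have := ltn_ord b; rewrite !ltnS => lb la.
by rewrite -(subKn lb) -e subKn.
Qed.

(* F_n is a single point, and it has no automorphism since c *: s = s only for
   c = 1. *)
Lemma in_FP n (s : form n) : in_F s <-> qm_iso (x1_pow n) s.
Proof.
split=> [[s0 _ ms]|[c c0 ->]].
  have le0 : local_eq s != 0.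
    apply: contraNneq s0 => e; apply/eqP/rowP => a.
    by rewrite mxE -coef_local_eq e coef0.
  have : ('X - 0%:P) ^+ n %| local_eq s by rewrite -mup_geq // ms.
  rewrite subr0 => /dvdpP [p pE].
  have co (a : 'I_n.+1) : a != ord0 -> s ord0 a = 0.
    move=> a0; rewrite -coef_local_eq pE coefMXn.
    have a_gt0 : (0 < a)%N by rewrite lt0n; apply: contraNneq a0 => e; apply/eqP/val_inj.
    by rewrite ltn_subrL a_gt0 (leq_trans a_gt0 (leq_ord a)).
  have sE : s = s ord0 ord0 *: x1_pow n.
    apply/rowP => a; rewrite !mxE /=; case: (eqVneq a ord0) => [->|/co ->];
      by rewrite ?mulr1 ?mulr0.
  exists (s ord0 ord0) => //; apply: contraNneq s0 => e.
  by rewrite sE e scale0r.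
have l1 : x1_pow n != 0.
  by apply/eqP => /rowP /(_ ord0) /eqP; rewrite !mxE !eqxx /= oner_eq0.
split; first by rewrite /is_quasimap scaler_eq0 negb_or c0.
- move=> t t0; exists 1; rewrite ?oner_eq0 // scale1r.
  rewrite -[in RHS](@act_x1 n t); apply/rowP => a; rewrite !mxE.
  by rewrite mulrCA.
- rewrite local_eqZ local_eq_x1.
  have nz : c *: 'X^n != 0 :> {poly C}.
    by rewrite scaler_eq0 negb_or c0 -size_poly_eq0 size_polyXn.
  apply/eqP; rewrite eqn_leq mup_leq // mup_geq // !dvdpZr // subr0 dvdpp andbT.
  by rewrite dvdp_Pexp2l ?size_polyX // ltnn.
Qed.

Lemma F_weight0 n : F_weight n = 0.
Proof.
have FP : in_F (F_point n).
  apply: (@xgetPex _ 0 [set s : form n | in_F s]).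
  by exists (x1_pow n); apply/in_FP; exists 1; rewrite ?oner_eq0 ?scale1r.
have [c c0 sE] := (in_FP _).1 FP.
have fix_s t : act t (F_point n) = F_point n.
  rewrite sE -[in RHS](@act_x1 n t); apply/rowP => a; rewrite !mxE.
  by rewrite mulrCA.
have kP : forall t : C, t != 0 -> act t (F_point n) = t ^ F_weight n *: F_point n.
  apply: (@xgetPex _ 0 [set k : int | forall t : C, t != 0 ->
                          act t (F_point n) = t ^ k *: F_point n]).
  by exists 0 => t _; rewrite fix_s expr0z scale1r.
have two0 : (2 : C) != 0 by rewrite pnatr_eq0.
have /rowP/(_ ord0) := kP 2 two0; rewrite fix_s sE !mxE !eqxx !mulr1 => e.
have /eqP : (2 : C) ^ F_weight n = 1 by apply: (mulIf c0); rewrite -e mul1r.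
rewrite pexprz_eq1 ?ler0n // => /orP[/eqP//|].
by rewrite pnatr_eq1.
Qed.

(* The multidegree-(a, d - a) piece of the Cech complex of O(d) for the cover
   x0 != 0, x1 != 0: the monomial x0^a x1^(d-a) is regular on the first chart
   iff a <= d, on the second iff 0 <= a, and always on the overlap. *)
Definition cech_diff (d a : int) : 'M[C]_((a <= d)%R + (0 <= a)%R, 1) :=
  col_mx (const_mx (-1)) (const_mx 1).

Definition h0 (d a : int) : nat := \rank (kermx (cech_diff d a)).
Definition h1 (d a : int) : nat := \rank (cokermx (cech_diff d a)).

(* Every a contributing to the cohomology of O(d) lies in [-|d|, |d|]. *)
Definition degrees (d : int) : seq int :=
  [seq k%:Z - `|d|%N%:Z | k <- iota 0 (2 * `|d|%N).+1].

Lemma cech_support (d a : int) :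
  a \notin degrees d -> (h0 d a = 0 /\ h1 d a = 0)%N.
Proof.
move=> aN; have {aN} aN : (a <= d)%R = ~~ (0 <= a)%R.
  suff : (a < - `|d|%N%:Z) || (`|d|%N%:Z < a) by lia.
  apply: contraNT aN; rewrite negb_or -!leNgt => /andP[a1 a2].
  apply/mapP; exists `|(a + `|d|%N%:Z)%R|%N; last by lia.
  by rewrite mem_iota; lia.
rewrite /h0 /h1 mxrank_ker mxrank_coker.
suff -> : \rank (cech_diff d a) = 1%N by rewrite aN; case: (0 <= a)%R.
apply/eqP; rewrite eqn_leq rank_leq_col lt0n mxrank_eq0.
apply/eqP => /matrixP e; move: e; rewrite /cech_diff aN.
case: (0 <= a)%R => /= e.
- have := e (rshift _ ord0) ord0; rewrite col_mxEd !mxE => /eqP.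
  by rewrite oner_eq0.
- have := e (lshift _ ord0) ord0; rewrite col_mxEu !mxE => /eqP.
  by rewrite oppr_eq0 oner_eq0.
Qed.

(* Under (t f)(x0, x1) = f(x0 / t, x1) the monomial x0^a x1^(d-a) has weight
   -a. *)
Definition coh_weights (h : int -> int -> nat) (d : int) : rep :=
  flatten [seq nseq (h d a) (- a, 0) | a <- degrees d].

Definition RGamma (d : int) : vrep :=
  (coh_weights h0 d, coh_weights h1 d).

(* The T-weight of L = P x_G C, the universal bundle before the action of T on
   X is taken into account: P carries the trivial lift of the T-action, so T
   acts through the coordinate z of C alone.
   Pitfall: the lift matters.  With the weight -1, which makes the universal
   section T-invariant, lam would cancel from the normal bundle. *)
Definition taut_weight : int := 0.

(* Representations of G = C^*, as lists of weights. *)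
Definition St : seq int := [:: 1].
Definition St_dual : seq int := [:: -1].

Definition vtens_char (c : int * int) (V : vrep) : vrep :=
  (tens_char c V.1, tens_char c V.2).

(* R pi_* (P x_G C_w) over F_n: the line bundle is L^-w, of degree - w n, and L
   is linearized so as to make the section in F_n invariant under C^*. *)
Definition assoc_coh (n : nat) (w : int) : vrep :=
  vtens_char (w * F_weight n, - w * taut_weight) (RGamma (- w * n%:Z)).

(* R pi_* of the bundle whose sections are the quasimaps, T scaling z by lam *)
Definition section_coh (n : nat) : vrep :=
  vtens_char (0, 1) (assoc_coh n (-1)).

(* T^vir = R pi_* (section bundle) - R pi_* (adjoint bundle), the adjoint bundle
   being O. *)
Definition Tvir (n : nat) : vrep :=
  ((section_coh n).1 ++ (assoc_coh n 0).2,
   (section_coh n).2 ++ (assoc_coh n 0).1).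

Definition Nvir (n : nat) : vrep :=
  (moving_part (Tvir n).1, moving_part (Tvir n).2).

(* F_n being smooth, O^vir is the Koszul class of the dual of the obstruction
   bundle, the C^*-fixed part of H^1 of the section bundle. *)
Definition tr_Ovir (n : nat) : Kloc :=
  tr_lambda (dual_rep (fixed_part (section_coh n).2)).

Definition tr_level (W : seq int) (l : int) (n : nat) : Kloc :=
  (\prod_(w <- W) vtr_det (assoc_coh n w)) ^ (- l).

Definition det_on_X (W : seq int) : Kloc :=
  \prod_(w <- W) wtK (0, - w * taut_weight).

(* K_T(X) has rank one over Repr(T): the bases dual for
   chi(u (x) v (x) det^-l) are reduced to one element each. *)
Definition phi_lower : Kloc := 1.
Definition phi_upper (W : seq int) (l : int) : Kloc := det_on_X W ^ l.

(* F_n is a point, so ev^* is the identity and chi(F_n, -) is the trace. *)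
Definition I_coef (W : seq int) (l : int) (n : nat) : Kloc :=
  tr_Ovir n * phi_lower * (tr_level W l n / vtr_lambda_dual (Nvir n))
    * phi_upper W l.

Definition one_plus (V : pzRingType) (u : nat -> V) (n : nat) : V :=
  if n is 0 then 1 else u n.

Definition I_function (W : seq int) (l : int) : nat -> Kloc :=
  one_plus (I_coef W l).

Definition has_sum (K : numFieldType) (u : nat -> K) (S : K) : Prop :=
  series u @ \oo --> S.

Definition eval_ql (q0 lam0 : C) (p : {poly {poly int}}) : C :=
  (map_poly (fun c : {poly int} => (map_poly intr c).[lam0]) p).[q0].

(* f is regular at (q0, lam0) with value v; this determines v. *)
Definition specializes (q0 lam0 : C) (f : Kloc) (v : C) : Prop :=
  exists x y : {poly {poly int}},
    [/\ eval_ql q0 lam0 y != 0, f = tofrac x / tofrac y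
      & v = eval_ql q0 lam0 x / eval_ql q0 lam0 y].

Definition specialized_sum (I : nat -> Kloc) (q0 lam0 Q0 S : C) : Prop :=
  exists u : nat -> C,
    (forall n, specializes q0 lam0 (I n) (u n)) /\
    has_sum (fun n => u n * Q0 ^+ n) S.

Definition specializes_to (I : nat -> Kloc) (q0 lam0 Q0 : C) (v : nat -> C) :=
  exists S : C, specialized_sum I q0 lam0 Q0 S /\
                has_sum (one_plus v) S.

End Quasimaps.

(* Main.v *)
Require Import Defs.
From mathcomp Require Import all_boot all_order all_algebra.
From mathcomp Require Import complex.
From mathcomp Require Import all_classical all_reals all_analysis.
From HB Require Import structures.
From mathcomp Require Import mxtens zify ring lra.
Import Order.TTheory GRing.Theory Num.Theory.
Local Open Scope ring_scope.

Set Implicit Arguments.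
Unset Strict Implicit.
Unset Printing Implicit Defensive.

(* G x T acts transitively on C \ 0 and the stabilizer of z = 1 is
   {(t^-1, t)}, a copy of C^*.  Hence an equivariant bundle is determined by the
   representation of C^* on its fibre over 1: translating along the orbit turns
   an intertwiner of these representations into an isomorphism of bundles.  The
   isomorphism onto Repr(T) is the trace of this representation; it is injective
   because a Laurent representation is a sum of weight spaces, the coefficients
   of rho(t) being orthogonal idempotents.

   F_n is a point with trivial linearization, T^vir is \sum_(k <= n) lam q^-k
   minus 1 and the level structure is the determinant of the cohomology of
   O(-n), resp. O(n), so every coefficient of I is an explicit product.  After
   specialization the n-th term is q^E(n) divided by a product of n factors
   bounded away from 0, where E(n+1) - E(n) >= n, and the ratio test applies. *)

(** * Laurent representations of the torus *)

Section Linear.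
Variable F : numFieldType.

(** In characteristic 0 the numbers 1, 2, ..., [size p] are distinct nonzero roots, too many for a
    nonzero [p]. *)
Lemma poly_eq0_nonzero (p : {poly F}) : (forall t, t != 0 -> p.[t] = 0) -> p = 0.
Proof.
move=> h; apply/eqP; apply: contraT => p0.
pose s := [seq i.+1%:R : F | i <- iota 0 (size p)].
suff: (size s < size p)%N by rewrite size_map size_iota ltnn.
apply: max_poly_roots => //.
  by apply/allP => _ /mapP[i _ ->]; rewrite /root h ?pnatr_eq0.
rewrite map_inj_uniq ?iota_uniq // => i j /eqP.
by rewrite eqr_nat => /eqP[].
Qed.

Lemma mx_coef_eq0 m n K (M : nat -> 'M[F]_(m, n)) :
  (forall t, t != 0 -> \sum_(k < K) t ^+ k *: M k = 0) ->
  forall k, (k < K)%N -> M k = 0.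
Proof.
move=> h k kK; apply/matrixP => i j.
pose p := \poly_(k < K) M k i j.
suff p0 : p = 0 by have := coef_poly K (fun k => M k i j) k; rewrite -/p p0 coef0 kK !mxE => <-.
apply: poly_eq0_nonzero => t /h /matrixP/(_ i j).
rewrite summxE mxE horner_poly => {2}<-.
by apply: eq_bigr => l _; rewrite mxE mulrC.
Qed.

(** Take the full-rank factorization [P = c *m b]; in [c b c b = c b] the full-rank factors cancel
    on both sides. *)
Lemma idempotent_factor n (P : 'M[F]_n) : P *m P = P ->
  exists d (c : 'M[F]_(n, d)) (b : 'M[F]_(d, n)), P = c *m b /\ b *m c = 1%:M.
Proof.
move=> PP; exists (\rank P), (col_base P), (row_base P).
move: (col_base P) (row_base P) (mulmx_base P) (col_base_full P)
  (row_base_free P) => c b Pcb c_full b_free; split; first by [].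
have : (c *m (b *m c)) *m b = c *m 1%:M *m b.
  by rewrite mulmx1 !mulmxA Pcb -mulmxA Pcb.
by move/(row_free_inj b_free)/(row_full_inj c_full).
Qed.

(** The trace of an idempotent is its rank, and characteristic 0 lets the trace recover it. Both
    images are then identified with the same space, and [U], [V] are the resulting inverse maps
    between them. *)
Lemma idempotent_equiv m n (P : 'M[F]_m) (Q : 'M[F]_n) :
  P *m P = P -> Q *m Q = Q -> \tr P = \tr Q ->
  exists (U : 'M[F]_(m, n)) (V : 'M[F]_(n, m)),
    [/\ U *m V = P, V *m U = Q, P *m U = U, U *m Q = U
      & Q *m V = V /\ V *m P = V].
Proof.
move=> /idempotent_factor[d [c [b [-> bc]]]] /idempotent_factor[d' [c' [b' [-> bc']]]].
rewrite [LHS]mxtrace_mulC bc [RHS]mxtrace_mulC bc' !mxtrace1 => /eqP.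
rewrite eqr_nat => /eqP dd; case: _ / dd c' b' bc' => c' b' bc'.
exists (c *m b'), (c' *m b); split.
- by rewrite mulmxA -(mulmxA c) bc' mulmx1.
- by rewrite mulmxA -(mulmxA c') bc mulmx1.
- by rewrite mulmxA -(mulmxA c) bc mulmx1.
- by rewrite mulmxA -(mulmxA c) bc' mulmx1.
- by rewrite !mulmxA -(mulmxA c') bc' mulmx1 -(mulmxA c') bc mulmx1.
Qed.

(** A section [h'] of [h] and a retraction [g] of [f] give [1 = g f + h h']; insert this after [M]
    and use cyclicity of the trace. *)
Lemma mxtrace_short_exact r' r r'' (f : 'M[F]_(r', r)) (h : 'M[F]_(r, r''))
    (M' : 'M[F]_r') (M : 'M[F]_r) (M'' : 'M[F]_r'') :
  row_free f -> (f :=: kermx h)%MS -> row_full h ->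
  M' *m f = f *m M -> M *m h = h *m M'' -> \tr M = \tr M' + \tr M''.
Proof.
move=> ff fh hf Mf Mh.
have /row_fullP[h' hh'] := hf.
have : ((1%:M - h *m h') <= f)%MS.
  by rewrite fh; apply/sub_kermxP; rewrite mulmxBl mul1mx -mulmxA hh' mulmx1 subrr.
case/submxP => g /eqP; rewrite subr_eq => /eqP E.
have fh0 : f *m h = 0 by apply/sub_kermxP; rewrite fh.
have gf : f *m g = 1%:M.
  apply: (row_free_inj ff); rewrite -mulmxA mul1mx -[RHS]mulmx1 E mulmxDr.
  by rewrite [_ *m (h *m _)]mulmxA fh0 mul0mx addr0.
rewrite -[M]mulmx1 E mulmxDr raddfD /=; congr (_ + _).
  by rewrite mulmxA mxtrace_mulC mulmxA -Mf -mulmxA gf mulmx1.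
by rewrite mulmxA Mh -mulmxA mxtrace_mulC -mulmxA hh' mulmx1.
Qed.

Lemma mxtrace_tens m n (A : 'M[F]_m) (B : 'M[F]_n) : \tr (A *t B) = \tr A * \tr B.
Proof.
rewrite /mxtrace mulr_sum.
by apply: eq_bigr => k _; rewrite mxE.
Qed.

Section WeightDecomposition.
Variables (r N K : nat) (rho : F -> 'M[F]_r) (P : nat -> 'M[F]_r).
Hypothesis rho1 : rho 1 = 1%:M.
Hypothesis rhoM : forall t u, t != 0 -> u != 0 -> rho (t * u) = rho t *m rho u.
Hypothesis rhoE : forall t, t != 0 ->
  t ^+ N *: rho t = \sum_(k < K) t ^+ k *: P k.

Lemma weight_proj_sum : \sum_(k < K) P k = 1%:M.
Proof.
have := rhoE (oner_neq0 _); rewrite expr1n scale1r rho1 => ->.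
by apply: eq_bigr => k _; rewrite expr1n scale1r.
Qed.

(** Compare the coefficients of [t^k u^l] in [rho (t u) = rho t *m rho u]: the left side has only
    diagonal terms. *)
Lemma weight_projM k l : (k < K)%N -> (l < K)%N ->
  P k *m P l = if k == l then P k else 0.
Proof.
move=> kK lK; apply/eqP; rewrite -subr_eq0; apply/eqP; move: l lK.
(* Independence of powers is applied first in [u] with [k] fixed, then in [t]. *)
apply: (@mx_coef_eq0 _ _ _ (fun l => P k *m P l - (if k == l then P k else 0))).
move=> u u0; move: k kK.
apply: (@mx_coef_eq0 _ _ _ (fun k => \sum_(l < K)
  u ^+ l *: (P k *m P l - (if k == l then P k else 0)))).
move=> t t0.
have : (t ^+ N *: rho t) *m (u ^+ N *: rho u) = (t * u) ^+ N *: rho (t * u).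
  by rewrite -scalemxAl -scalemxAr scalerA exprMn rhoM.
rewrite !rhoE ?mulf_neq0 // => /eqP; rewrite -subr_eq0 => /eqP e.
rewrite -[RHS]e mulmx_suml -sumrB; apply: eq_bigr => k _.
rewrite -scalemxAl exprMn -scalerA -scalerBr; congr (_ *: _).
under eq_bigr do rewrite scalerBr.
rewrite sumrB mulmx_sumr; congr (_ - _).
  by apply: eq_bigr => l _; rewrite scalemxAr.
rewrite (bigD1 k) //= eqxx big1 ?addr0 // => l.
by rewrite -val_eqE eq_sym => /negbTE /= ->; rewrite scaler0.
Qed.

End WeightDecomposition.

(** Equal traces make corresponding weight projections have equal rank. The sum of the isomorphisms
    between weight spaces is [S], and the sum of their inverses is its inverse [T]. *)
Lemma equal_trace_intertwiner r s N K (rho : F -> 'M[F]_r) (sig : F -> 'M[F]_s)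
    (P : nat -> 'M[F]_r) (Q : nat -> 'M[F]_s) :
  rho 1 = 1%:M -> sig 1 = 1%:M ->
  (forall t u, t != 0 -> u != 0 -> rho (t * u) = rho t *m rho u) ->
  (forall t u, t != 0 -> u != 0 -> sig (t * u) = sig t *m sig u) ->
  (forall t, t != 0 -> t ^+ N *: rho t = \sum_(k < K) t ^+ k *: P k) ->
  (forall t, t != 0 -> t ^+ N *: sig t = \sum_(k < K) t ^+ k *: Q k) ->
  (forall t, t != 0 -> \tr (rho t) = \tr (sig t)) ->
  exists S : 'M[F]_(r, s), [/\ row_free S, row_full S
    & forall t, t != 0 -> rho t *m S = S *m sig t].
Proof.
move=> rho1 sig1 rhoM sigM rhoE sigE trE.
have PM := weight_projM rhoM rhoE.
have QM := weight_projM sigM sigE.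
have trPQ k : (k < K)%N -> \tr (P k) = \tr (Q k).
  move=> kK; apply/eqP; rewrite -subr_eq0; apply/eqP.
  (* The traces are packed as 1 x 1 matrices so that independence of powers applies to them. *)
  have := @mx_coef_eq0 1 1 K (fun k => (\tr (P k) - \tr (Q k))%:M) _ k kK.
  move=> /(_ _)/matrixP/(_ ord0 ord0); rewrite !mxE; apply.
  move=> t t0; have := congr1 (fun x => t ^+ N * x) (trE t t0).
  rewrite -!mxtraceZ rhoE // sigE // !raddf_sum /= => /eqP.
  rewrite -subr_eq0 -sumrB => /eqP e; apply/matrixP => i j.
  rewrite !ord1 summxE mxE -[RHS]e; apply: eq_bigr => l _.
  by rewrite !mxE eqxx mulr1n !mxtraceZ mulrBr.
have ex (k : 'I_K) : exists UV : 'M[F]_(r, s) * 'M[F]_(s, r),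
    [/\ UV.1 *m UV.2 = P k, UV.2 *m UV.1 = Q k, P k *m UV.1 = UV.1,
        UV.1 *m Q k = UV.1 & Q k *m UV.2 = UV.2 /\ UV.2 *m P k = UV.2].
  have [||U [V H]] := @idempotent_equiv _ _ (P k) (Q k) _ _ (trPQ k (ltn_ord k)).
  - by rewrite PM ?eqxx.
  - by rewrite QM ?eqxx.
  by exists (U, V).
case/choice: ex => UV H.
pose S := \sum_k (UV k).1; pose T := \sum_k (UV k).2.
have PS (k : 'I_K) : P k *m S = (UV k).1.
  rewrite mulmx_sumr (bigD1 k) //= big1 ?addr0; first by case: (H k).
  move=> l lk; case: (H l) => _ _ <- _ _; rewrite mulmxA PM //.
  by rewrite -val_eqE /= eq_sym in lk; rewrite (negbTE lk) mul0mx.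
have SQ (k : 'I_K) : S *m Q k = (UV k).1.
  rewrite mulmx_suml (bigD1 k) //= big1 ?addr0; first by case: (H k).
  move=> l lk; case: (H l) => _ _ _ <- _; rewrite -mulmxA QM //.
  by rewrite -val_eqE /= in lk; rewrite (negbTE lk) mulmx0.
have QT (k : 'I_K) : Q k *m T = (UV k).2.
  rewrite mulmx_sumr (bigD1 k) //= big1 ?addr0; first by case: (H k) => _ _ _ _ [].
  move=> l lk; have [_ _ _ _ [<- _]] := H l; rewrite mulmxA QM //.
  by rewrite -val_eqE /= eq_sym in lk; rewrite (negbTE lk) mul0mx.
have ST : S *m T = 1%:M.
  rewrite -(weight_proj_sum rho1 rhoE) mulmx_suml; apply: eq_bigr => k _.
  by have [<- _ _ UQ _] := H k; rewrite -{1}UQ -mulmxA QT.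
have TS : T *m S = 1%:M.
  rewrite -(weight_proj_sum sig1 sigE) mulmx_suml; apply: eq_bigr => k _.
  by have [_ <- _ _ [_ VP]] := H k; rewrite -{1}VP -mulmxA PS.
exists S; split; first by apply/row_freeP; exists T.
  by apply/row_fullP; exists T.
move=> t t0; have tN : t ^+ N != 0 by rewrite expf_neq0.
apply: (scalerI tN); rewrite scalemxAl rhoE // scalemxAr sigE //.
rewrite mulmx_suml mulmx_sumr; apply: eq_bigr => k _.
by rewrite -scalemxAl -scalemxAr PS SQ.
Qed.

End Linear.

(** * Laurent functions and their integral characters *)

Section Laurent.
Variable R : realType.
Local Notation C := (complex R).
Implicit Types (f g a b c : C -> C) (r s : nat).

Lemma eq_laurent1 f g : (forall z, z != 0 -> f z = g z) -> laurent1 f -> laurent1 g.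
Proof. by move=> fg [N [p h]]; exists N, p => z z0; rewrite -fg ?h. Qed.

Lemma laurent1_cst (k : C) : laurent1 (fun=> k).
Proof. by exists 0%N, k%:P => z _; rewrite hornerC mul1r. Qed.

Lemma laurent1_id : @laurent1 R id.
Proof. by exists 0%N, 'X => z _; rewrite hornerX mul1r. Qed.

Lemma laurent1_inv : @laurent1 R (fun z => z^-1).
Proof. by exists 1%N, 1%:P => z z0; rewrite hornerC mulfV. Qed.

Lemma laurent1D f g : laurent1 f -> laurent1 g -> laurent1 (fun z => f z + g z).
Proof.
move=> [N [p hp]] [M [q hq]]; exists (N + M)%N, ('X^M * p + 'X^N * q) => z z0.
by rewrite hornerD !hornerM !hornerXn -hp // -hq // exprD; ring.
Qed.

Lemma laurent1M f g : laurent1 f -> laurent1 g -> laurent1 (fun z => f z * g z).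
Proof.
move=> [N [p hp]] [M [q hq]]; exists (N + M)%N, (p * q) => z z0.
by rewrite hornerM -hp // -hq // exprD; ring.
Qed.

Lemma laurent1X f n : laurent1 f -> laurent1 (fun z => f z ^+ n).
Proof.
move=> hf; elim: n => [|n IH]; first exact: laurent1_cst.
by apply: eq_laurent1 (laurent1M hf IH) => z _; rewrite exprS.
Qed.

Lemma laurent1_sum (I : Type) (s : seq I) (F : I -> C -> C) :
  (forall i, laurent1 (F i)) -> laurent1 (fun z => \sum_(i <- s) F i z).
Proof.
move=> hF; elim: s => [|i s IH].
  by apply: eq_laurent1 (laurent1_cst 0) => z _; rewrite big_nil.
by apply: eq_laurent1 (laurent1D (hF i) IH) => z _; rewrite big_cons.
Qed.

(** Induction along the Horner scheme. The abstract [D] and [ev] let one lemma treat each of the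
    three nested variables of [laurent3]. *)
Lemma laurent1_horner (D : nzRingType) (ev : C -> D -> C) (x : C -> D)
    (p : {poly D}) :
  (forall z, ev z 0 = 0) ->
  (forall z u v, ev z (u * x z + v) = ev z u * ev z (x z) + ev z v) ->
  laurent1 (fun z => ev z (x z)) -> (forall d, laurent1 (ev^~ d)) ->
  laurent1 (fun z => ev z p.[x z]).
Proof.
move=> ev0 evL hx hd; elim/poly_ind: p => [|p d IH].
  by apply: eq_laurent1 (laurent1_cst 0) => z _; rewrite horner0.
apply: eq_laurent1 (laurent1D (laurent1M IH hx) (hd d)) => z _.
by rewrite hornerMXaddC evL.
Qed.

Lemma laurent3_comp (F : C -> C -> C -> C) a b c :
  laurent3 F -> (forall z, z != 0 -> [/\ a z != 0, b z != 0 & c z != 0]) ->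
  laurent1 a -> laurent1 b -> laurent1 c ->
  laurent1 (fun z => (a z * b z * c z)^-1) ->
  laurent1 (fun z => F (a z) (b z) (c z)).
Proof.
move=> [N [p hp]] nz ha hb hc hV.
suff hq : laurent1 (fun z => p.[(c z)%:P%:P].[(b z)%:P].[a z]).
  apply: eq_laurent1 (laurent1M (laurent1X N hV) hq) => z z0.
  have [a0 b0 c0] := nz z z0; rewrite -hp // mulrA -exprMn mulVf.
    by rewrite expr1n mul1r.
  by rewrite !mulf_neq0.
apply: (@laurent1_horner _ (fun z d => d.[(b z)%:P].[a z]) (fun z => (c z)%:P%:P)).
- by move=> z; rewrite !horner0.
- by move=> z u v; rewrite !(hornerD, hornerM).
- by apply: eq_laurent1 hc => z _; rewrite !hornerC.
move=> d; apply: (@laurent1_horner _ (fun z e => e.[a z]) (fun z => (b z)%:P)).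
- by move=> z; rewrite !horner0.
- by move=> z u v; rewrite !(hornerD, hornerM).
- by apply: eq_laurent1 hb => z _; rewrite !hornerC.
move=> e; apply: (@laurent1_horner _ (fun=> id) a) => // k.
exact: laurent1_cst.
Qed.

(** All entries get a common denominator and degree bound. Every larger [N] and [K] is allowed so
    that two representations can be expanded with the same ones. *)
Lemma laurent_mx r s (M : C -> 'M[C]_(r, s)) :
  (forall i j, laurent1 (fun z => M z i j)) ->
  exists N0, forall N, (N0 <= N)%N -> exists K0 (P : nat -> 'M[C]_(r, s)),
    forall K, (K0 <= K)%N -> forall t, t != 0 ->
      t ^+ N *: M t = \sum_(k < K) t ^+ k *: P k.
Proof.
move=> hM.
have /choice[n hn] (ij : 'I_r * 'I_s) := hM ij.1 ij.2.
have /choice[p hp] := hn.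
exists (\sum_ij n ij)%N => N leN.
pose q ij := 'X^(N - n ij) * p ij.
exists (\sum_ij size (q ij))%N, (fun k => \matrix_(i, j) (q (i, j))`_k).
move=> K leK t t0; apply/matrixP => i j.
have le_n : (n (i, j) <= N)%N by apply: leq_trans leN; rewrite (bigD1 (i, j)) ?leq_addr.
have le_q : (size (q (i, j)) <= K)%N.
  by apply: leq_trans leK; rewrite (bigD1 (i, j)) ?leq_addr.
transitivity (q (i, j)).[t].
  by rewrite mxE hornerM hornerXn -(hp (i, j)) // mulrA -exprD subnK.
rewrite summxE (horner_coef_wide _ le_q); apply: eq_bigr => k _.
by rewrite !mxE mulrC.
Qed.

Lemma lamK_neq0 : lamK != 0.
Proof. by rewrite /lamK tofrac_eq0 polyC_eq0 polyX_eq0. Qed.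

Lemma tofrac_polyC_inj (p q : {poly int}) : tofrac p%:P = tofrac q%:P :> Kloc -> p = q.
Proof. by move/eqP; rewrite tofrac_eq => /eqP/polyC_inj. Qed.

Lemma intr_poly_inj : injective (map_poly intr : {poly int} -> {poly C}).
Proof. by apply: map_inj_poly => //; apply: intr_inj. Qed.

(* x is the element of Z[lam^+-1] whose values are those of f. *)
Definition has_char f (x : Kloc) : Prop :=
  exists (N : nat) (p : {poly int}), lamK ^+ N * x = tofrac p%:P /\
    forall t, t != 0 -> t ^+ N * f t = (map_poly intr p).[t].

(** After clearing denominators both sides say ['X^M * p = 'X^N * q]: integers embed in [C], and a
    polynomial is determined by its values at nonzero points. *)
Lemma has_char_inj f g x y : has_char f x -> has_char g y ->
  x = y <-> forall t, t != 0 -> f t = g t.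
Proof.
move=> [N [p [xE fE]]] [M [q [yE gE]]].
have e1 : x = y <-> 'X^M * p = 'X^N * q.
  have lamE k (u : {poly int}) : lamK ^+ k * tofrac u%:P = tofrac ('X^k * u)%:P.
    by rewrite /lamK -tofracXn -tofracM -polyC_exp -polyCM.
  split=> [xy|/(congr1 (fun u : {poly int} => tofrac u%:P : Kloc))].
    apply: tofrac_polyC_inj; rewrite -!lamE -xE -yE xy.
    by rewrite mulrCA.
  rewrite -!lamE -xE -yE mulrCA.
  by move=> /(mulfI (expf_neq0 _ lamK_neq0))/(mulfI (expf_neq0 _ lamK_neq0)).
rewrite e1; split.
  move=> /(congr1 (map_poly intr : {poly int} -> {poly C})).
  rewrite !rmorphM /= !map_polyXn => e t t0.
  have := congr1 (horner^~ t) e; rewrite /= !hornerM !hornerXn -fE // -gE //.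
  rewrite mulrA [RHS]mulrA -!exprD [(M + N)%N]addnC.
  by apply: mulfI; rewrite expf_neq0.
move=> fg; apply: intr_poly_inj; rewrite !rmorphM /= !map_polyXn.
apply/eqP; rewrite -subr_eq0; apply/eqP; apply: poly_eq0_nonzero => t t0.
by rewrite hornerD hornerN !hornerM !hornerXn -fE // -gE // fg //; ring.
Qed.

Lemma eq_has_char f g x : (forall t, t != 0 -> f t = g t) -> has_char f x -> has_char g x.
Proof. by move=> fg [N [p [h k]]]; exists N, p; split=> // t t0; rewrite -fg ?k. Qed.

Lemma has_charD f g x y :
  has_char f x -> has_char g y -> has_char (fun t => f t + g t) (x + y).
Proof.
move=> [N [p [xE fE]]] [M [q [yE gE]]].
exists (N + M)%N, ('X^M * p + 'X^N * q); split=> [|t t0].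
  rewrite polyCD !polyCM !polyC_exp tofracD !tofracM !tofracXn -/lamK.
  by rewrite -xE -yE exprD; ring.
rewrite rmorphD !rmorphM /= !map_polyXn hornerD !hornerM !hornerXn -fE // -gE //.
by rewrite exprD; ring.
Qed.

Lemma has_charM f g x y :
  has_char f x -> has_char g y -> has_char (fun t => f t * g t) (x * y).
Proof.
move=> [N [p [xE fE]]] [M [q [yE gE]]].
exists (N + M)%N, (p * q); split=> [|t t0].
  by rewrite polyCM tofracM -xE -yE exprD; ring.
by rewrite rmorphM /= hornerM -fE // -gE // exprD; ring.
Qed.

Lemma has_char_nat n : has_char (fun=> n%:R) n%:R.
Proof.
exists 0%N, n%:R; split=> [|t _]; first by rewrite mul1r !rmorph_nat.
by rewrite rmorph_nat mul1r -polyC_natr hornerC.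
Qed.

Lemma has_char_exp (k : int) : has_char (fun t => t ^ k) (lamK ^ k).
Proof.
case: k => n.
  exists 0%N, 'X^n; split=> [|t _]; first by rewrite mul1r polyC_exp tofracXn.
  by rewrite map_polyXn hornerXn mul1r.
exists n.+1, 1; split=> [|t t0]; first by rewrite NegzE -exprnN mulfV ?expf_neq0 ?lamK_neq0 ?rmorph1.
by rewrite rmorph1 hornerC NegzE -exprnN mulfV ?expf_neq0.
Qed.

Lemma has_char_sum (I : Type) (s : seq I) (F : I -> C -> C) (X : I -> Kloc) :
  (forall i, has_char (F i) (X i)) ->
  has_char (fun t => \sum_(i <- s) F i t) (\sum_(i <- s) X i).
Proof.
move=> h; elim: s => [|i s IH].
  by rewrite big_nil; apply: eq_has_char (has_char_nat 0) => t _; rewrite big_nil.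
by rewrite big_cons; apply: eq_has_char (has_charD (h i) IH) => t _; rewrite big_cons.
Qed.

End Laurent.

(** * The equivariant K-ring *)

Section KTheory.
Variable R : realType.
Local Notation C := (complex R).
Implicit Types (r s : nat).

(* The pairs (t^-1, t) form the stabilizer of z = 1. *)
Definition stab_rep r (A : cocycle R r) (t : C) : 'M[C]_r := A t^-1 t 1.

(** By [has_char_inj] at most one [x] qualifies. The default 0 is taken only if there is none, which
    [bundle_has_char] excludes for equivariant bundles. *)
Definition Kchar r (A : cocycle R r) : Kloc :=
  xget 0 [set x | has_char (fun t => \tr (stab_rep A t)) x]%classic.

Lemma Kchar_eq r (A : cocycle R r) x :
  has_char (fun t => \tr (stab_rep A t)) x -> Kchar A = x.
Proof.
move=> h; have h' : has_char (fun t => \tr (stab_rep A t)) (Kchar A).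
  exact: (@xgetPex _ 0 [set x | has_char (fun t => \tr (stab_rep A t)) x]%classic (ex_intro _ x h)).
by apply/(has_char_inj h' h).
Qed.

Section Bundle.
Variables (r : nat) (A : cocycle R r).
Hypothesis bA : eq_bundle A.

Lemma stab_rep1 : stab_rep A 1 = 1%:M.
Proof. by case: bA => _ A1 _; rewrite /stab_rep invr1 A1 ?oner_neq0. Qed.

Lemma stab_repM t u : t != 0 -> u != 0 ->
  stab_rep A (t * u) = stab_rep A t *m stab_rep A u.
Proof.
case: bA => _ _ AM t0 u0; rewrite /stab_rep mulrC invfM AM ?invr_eq0 ?oner_neq0 //.
by rewrite mulVf ?mulr1.
Qed.

Lemma stab_rep_laurent i j : laurent1 (fun t => stab_rep A t i j).
Proof.
case: bA => Al _ _.
apply: (laurent3_comp (a := fun t => t^-1) (b := id) (c := fun=> 1) (Al i j)).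
- by move=> z z0; rewrite invr_eq0 z0 oner_neq0.
- exact: laurent1_inv.
- exact: laurent1_id.
- exact: laurent1_cst.
by apply: eq_laurent1 (laurent1_cst 1) => z z0; rewrite mulVf // mulr1 invr1.
Qed.

(** The coefficients of the stabilizer representation are idempotent, so their traces are ranks: the
    trace is a sum of [d_k t^(k - N)] with natural multiplicities [d_k]. *)
Lemma bundle_has_char : has_char (fun t => \tr (stab_rep A t)) (Kchar A).
Proof.
suff [x hx] : exists x, has_char (fun t => \tr (stab_rep A t)) x.
  by rewrite (Kchar_eq hx).
have [N /(_ _ (leqnn _))[K [P /(_ _ (leqnn _)) AE]]] := laurent_mx stab_rep_laurent.
have d_ex (k : 'I_K) : exists d : nat, \tr (P k) = d%:R.
  have PP : P k *m P k = P k by rewrite (weight_projM stab_repM AE) ?eqxx.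
  have [d [c [b [-> bc]]]] := idempotent_factor PP.
  by exists d; rewrite mxtrace_mulC bc mxtrace1.
have [d dE] := choice d_ex.
exists (\sum_(k < K) lamK ^ (k%:Z - N%:Z) * (d k)%:R).
have := has_char_sum (index_enum 'I_K) (fun k : 'I_K =>
  has_charM (has_char_exp R (k%:Z - N%:Z)) (has_char_nat R (d k))).
apply: eq_has_char => t t0; apply: (mulfI (expf_neq0 N t0)).
rewrite -mxtraceZ AE // raddf_sum /= mulr_sumr; apply: eq_bigr => k _.
by rewrite mxtraceZ dE mulrA exprnP -expfzDr // addrC subrK.
Qed.

End Bundle.

(** Restrict the exact sequence to the fibre over 1, where the bundle maps commute with the
    stabilizer. *)
Lemma Kchar_additive : additive_invariant Kchar.
Proof.
move=> r' r r'' A' A A'' b' b b'' [f [h [[_ fM] [_ hM] ex]]].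
apply: Kchar_eq; apply: eq_has_char (has_charD (bundle_has_char b') (bundle_has_char b'')).
move=> t t0; have [f_free fh h_full] := ex 1 (oner_neq0 _).
have V0 : t^-1 != 0 by rewrite invr_eq0.
have := fM t^-1 t 1 V0 t0 (oner_neq0 _); have := hM t^-1 t 1 V0 t0 (oner_neq0 _).
rewrite mulr1 mulVf // => hE fE.
by rewrite (mxtrace_short_exact f_free fh h_full fE hE).
Qed.

Lemma Kchar_tens r s (A : cocycle R r) (B : cocycle R s) :
  eq_bundle A -> eq_bundle B -> Kchar (tens_bundle A B) = Kchar A * Kchar B.
Proof.
move=> bA bB; apply: Kchar_eq.
apply: eq_has_char (has_charM (bundle_has_char bA) (bundle_has_char bB)) => t _.
by rewrite /stab_rep /tens_bundle mxtrace_tens.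
Qed.

(* The translates A z 1 1 from the fibre over 1 carry an intertwiner of the
   stabilizer representations to an isomorphism of bundles. *)
Lemma intertwiner_short_exact r s (A : cocycle R r) (B : cocycle R s)
    (S : 'M[C]_(r, s)) :
  eq_bundle A -> eq_bundle B -> row_free S -> row_full S ->
  (forall t, t != 0 -> stab_rep A t *m S = S *m stab_rep B t) ->
  short_exact A B (fun _ _ _ => 0 : 'M[C]_0).
Proof.
move=> [Al A1 AM] [Bl B1 BM] S_free S_full SE.
(* [T z] carries the fibre over [z] back to the fibre over 1. *)
pose T z := A z^-1 1 z.
have AT z : z != 0 -> A z 1 1 *m T z = 1%:M.
  move=> z0; have := AM z^-1 1 z 1 1.
  by rewrite mulVf // !mulr1 A1 ?invr_eq0 ?oner_neq0 // => <-.
have TA z : z != 0 -> T z *m A z 1 1 = 1%:M by move=> z0; apply/mulmx1C/AT.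
(* Both sides are the action of [(g z, t)] on the fibre over 1, factored through [z] or through the
   stabilizer. *)
have orbit r0 (D : cocycle R r0) : eq_bundle D -> forall g t z,
    g != 0 -> t != 0 -> z != 0 ->
    D z 1 1 *m D g t z = stab_rep D t *m D (g * t * z) 1 1.
  move=> [_ _ DM] g t z g0 t0 z0.
  have := DM g t z 1 1; rewrite !mulr1 => <- //; rewrite ?oner_neq0 //.
  have := DM (g * t * z) 1 t^-1 t 1.
  rewrite mul1r mulr1 mulVf // => <- //; rewrite ?mulf_neq0 ?invr_eq0 ?oner_neq0 //.
  by congr (D _ _ _); field.
(* Move back to the fibre over 1, apply [S], then move out to [z] in [B]. *)
exists (fun z => T z *m S *m B z 1 1), (fun=> 0); split.
- split=> [i j|g t z g0 t0 z0].
    apply: (@eq_laurent1 _ (fun z => \sum_k (\sum_l T z i l * S l k) * B z 1 1 k j)).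
      by move=> z _; rewrite mxE; apply: eq_bigr => k _; rewrite mxE.
    apply: laurent1_sum => k; apply: laurent1M.
      apply: laurent1_sum => l; apply: laurent1M; last exact: laurent1_cst.
      apply: (laurent3_comp (a := fun z => z^-1) (b := fun=> 1) (c := id) (Al i l)).
      + by move=> z z0; rewrite invr_eq0 z0 oner_neq0.
      + exact: laurent1_inv.
      + exact: laurent1_cst.
      + exact: laurent1_id.
      by apply: eq_laurent1 (laurent1_cst 1) => z z0; rewrite mulr1 mulVf // invr1.
    apply: (laurent3_comp (a := id) (b := fun=> 1) (c := fun=> 1) (Bl k j)).
    + by move=> z z0; rewrite z0 oner_neq0.
    + exact: laurent1_id.
    + exact: laurent1_cst.
    + exact: laurent1_cst.
    by apply: eq_laurent1 (@laurent1_inv R) => z z0; rewrite !mulr1.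
  have gtz0 : g * t * z != 0 by rewrite !mulf_neq0.
  have AE : A g t z = T z *m stab_rep A t *m A (g * t * z) 1 1.
    by rewrite -mulmxA -orbit // mulmxA TA // mul1mx.
  rewrite AE -!mulmxA [A _ _ _ *m (T _ *m _)]mulmxA AT // mul1mx.
  rewrite [stab_rep A t *m _]mulmxA SE // -!mulmxA.
  by rewrite orbit.
- split=> [i j|g t z _ _ _]; last by rewrite mulmx0 mul0mx.
  by case: j.
move=> z z0.
have Bz : B z 1 1 \in unitmx.
  have := BM z^-1 1 z 1 1; rewrite mulVf // !mulr1 B1 ?invr_eq0 ?oner_neq0 //.
  by move=> /(_ _ _ _ _ _)/esym/mulmx1_unit[]//.
have [/row_freeP[S' SS'] /row_fullP[S'' S''S]] := (S_free, S_full).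
split.
- apply/row_freeP; exists (invmx (B z 1 1) *m S' *m A z 1 1).
  by rewrite !mulmxA mulmxK // -(mulmxA (T z)) SS' mulmx1 TA.
- apply/eqmxP; rewrite andbC; apply/andP; split.
    apply: submx_full; apply/row_fullP; exists (invmx (B z 1 1) *m S'' *m A z 1 1).
    rewrite !mulmxA -(mulmxA _ (A z 1 1)) AT // mulmx1.
    by rewrite -(mulmxA _ S'' S) S''S mulmx1 mulVmx.
  by apply/sub_kermxP; rewrite mulmx0.
by rewrite /row_full mxrank0.
Qed.

Lemma zero_bundle : eq_bundle (fun _ _ _ => 0 : 'M[C]_0).
Proof.
split=> [[]//|z _|*]; first by apply/matrixP => -[].
by rewrite mul0mx.
Qed.

(** This forces an additive invariant to satisfy [f Z = f Z + f Z], hence to vanish on the zero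
    bundle. *)
Lemma zero_short_exact (Z : cocycle R 0) : short_exact Z Z Z.
Proof.
exists (fun=> 0), (fun=> 0); split.
- by split=> [[]//|*]; apply/matrixP => -[].
- by split=> [[]//|*]; apply/matrixP => -[].
move=> z _; split; rewrite /row_free /row_full ?mxrank0 //.
by apply/eqmxP; rewrite sub0mx /= [kermx _]flatmx0 sub0mx.
Qed.

Lemma Kchar_inj r s (A : cocycle R r) (B : cocycle R s) :
  eq_bundle A -> eq_bundle B -> Kchar A = Kchar B ->
  forall (V : zmodType) (f : forall r, cocycle R r -> V),
    additive_invariant f -> f r A = f s B.
Proof.
move=> bA bB /(has_char_inj (bundle_has_char bA) (bundle_has_char bB)) trE V f fadd.
have [NA hA] := laurent_mx (stab_rep_laurent bA).
have [NB hB] := laurent_mx (stab_rep_laurent bB).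
(* The exponent [NA + NB] and the bound [KA + KB] serve both representations. *)
have [KA [P AE]] := hA _ (leq_addr NB NA).
have [KB [Q BE]] := hB _ (leq_addl NA NB).
have [S [S_free S_full SE]] :=
  equal_trace_intertwiner (stab_rep1 bA) (stab_rep1 bB) (stab_repM bA) (stab_repM bB)
    (AE _ (leq_addr KB KA)) (BE _ (leq_addl KA KB)) trE.
have := fadd _ _ _ _ _ _ bA bB zero_bundle (intertwiner_short_exact bA bB S_free S_full SE).
have := fadd _ _ _ _ _ _ zero_bundle zero_bundle zero_bundle (zero_short_exact _).
by move/eqP; rewrite -subr_eq subrr => /eqP <-; rewrite addr0.
Qed.

(** The pullback to X of the representation of T with weights [w]; such bundles realise every class
    of [Repr(T)]. *)
Definition diag_bundle (w : seq int) : cocycle R (size w) :=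
  fun _ t _ => diag_mx (\row_i t ^ (nth 0 w i)).

Lemma diag_bundleP w : eq_bundle (diag_bundle w).
Proof.
split=> [i j|z _|g t g' t' z _ t0 _ t'0 _].
- pose k := nth 0 w i; pose N := `|k|%N; pose M := `|(N%:Z + k)%R|%N.
  (* From the outermost variable inwards the factors are [z^N], [t^M = t^(N + k)] and [g^N];
     [N = |k|] keeps [N + k] nonnegative. *)
  exists N, ('X^N * ('X^M)%:P * ('X^N *+ (i == j))%:P%:P) => g t z g0 t0 z0.
  rewrite !(hornerM, hornerC, hornerXn) -!polyC_exp !(hornerM, hornerC, hornerXn).
  rewrite hornerMn hornerXn !mxE -/k.
  have tM : t ^+ M = t ^+ N * t ^ k.
    have MN : M%:Z = N%:Z + k by rewrite /M /N; lia.
    by rewrite !exprnP MN expfzDr.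
  by rewrite tM; case: eqP => _; rewrite ?mulr1n ?mulr0n ?mulr0 // !exprMn; ring.
- by apply/matrixP => i j; rewrite !mxE exp1rz.
by rewrite mulmx_diag; congr diag_mx; apply/rowP => i; rewrite !mxE mulrC expfzMl.
Qed.

Lemma Kchar_diag w : Kchar (diag_bundle w) = \sum_(k <- w) lamK ^ k.
Proof.
apply: Kchar_eq; have := has_char_sum w (has_char_exp R).
apply: eq_has_char => t _; rewrite (big_nth 0) big_mkord /mxtrace.
by apply: eq_bigr => i _; rewrite !mxE eqxx mulr1n.
Qed.

(** Differences of sums of powers of [lamK] are closed under sums and integer multiples, and
    dividing [p] by [lamK ^+ N] writes [x] as an integer combination of powers. *)
Lemma ReprT_diff x : ReprT x -> exists w w' : seq int,
  x = \sum_(k <- w) lamK ^ k - \sum_(k <- w') lamK ^ k.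
Proof.
pose D (y : Kloc) := exists w w' : seq int,
  y = \sum_(k <- w) lamK ^ k - \sum_(k <- w') lamK ^ k.
have D0 : D 0 by exists [::], [::]; rewrite !big_nil subr0.
have DN y : D y -> D (- y) by move=> [w [w' ->]]; exists w', w; rewrite opprB.
have DD y z : D y -> D z -> D (y + z).
  move=> [w [w' ->]] [v [v' ->]]; exists (w ++ v), (w' ++ v').
  by rewrite !big_cat /= opprD addrACA.
have Dn y n : D y -> D (y *+ n).
  by move=> Dy; elim: n => [|n IH]; rewrite ?mulr0n // mulrS; apply: DD.
have Dz y (m : int) : D y -> D (y *~ m).
  by case: m => n Dy; rewrite ?NegzE ?mulrNz; [exact: Dn|apply/DN/Dn].
move=> [N [p xE]].
have -> : x = \sum_(i < size p) (lamK ^ (i%:Z - N%:Z)) *~ p`_i.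
  apply: (mulfI (expf_neq0 N lamK_neq0)); rewrite xE mulr_sumr.
  rewrite -[p in LHS]coefK poly_def !rmorph_sum; apply: eq_bigr => i _ /=.
  rewrite mulrzAr [lamK ^+ N]exprnP -expfzDr ?lamK_neq0 // addrC subrK.
  by rewrite -mul_polyC -[p`_i in LHS]intz !rmorphM /= !rmorph_int polyC_exp tofracXn mulrzl.
elim/big_rec: _ => // i y _ Dy; apply: DD => //; apply: Dz.
by exists [:: i%:Z - N%:Z], [::]; rewrite big_nil big_seq1 subr0.
Qed.

Lemma exists_K_iso : exists ch : forall r, cocycle R r -> Kloc, K_iso ch.
Proof.
exists Kchar; split.
- exact: Kchar_additive.
- exact: Kchar_tens.
- apply: Kchar_eq; apply: eq_has_char (has_char_nat R 1) => t _.
  by rewrite /stab_rep mxtrace1.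
- exact: Kchar_inj.
split.
- move=> r A bA; have [N [p [h _]]] := bundle_has_char bA.
  by exists N, p.
- move=> x /ReprT_diff[w [w' ->]].
  exists (size w), (size w'), (diag_bundle w), (diag_bundle w').
  by rewrite !Kchar_diag; split=> //; apply: diag_bundleP.
apply: Kchar_eq; apply: eq_has_char (has_char_exp R 1) => t _.
by rewrite /stab_rep mxtrace_scalar.
Qed.

End KTheory.

(** * Coefficients of the I-function *)

(** Expand the product over subsets of the weights and group the subsets by cardinality. *)
Lemma tr_lambdaE (V : rep) : tr_lambda V = \prod_(w <- V) (1 - wtK w).
Proof.
rewrite (big_nth (0, 0)) big_mkord.
under eq_bigr do rewrite addrC.
rewrite bigA_distr /=.
(* A cardinality is at most [size V], so [inord] loses nothing. *)
rewrite (partition_big (fun A : {set 'I_(size V)} => inord #|A| : 'I_(size V).+1) xpredT) //=.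
rewrite /tr_lambda big_mkord; apply: eq_bigr => k _.
rewrite /tr_wedge mulr_sumr; apply: eq_big => A.
  rewrite -val_eqE /= inordK //.
  by rewrite ltnS (leq_trans (max_card _)) ?card_ord.
move=> /eqP <-; rewrite -big_mkcond /= -prodrN.
by [].
Qed.


Lemma filter_iota_interval m a b : (b <= m)%N ->
  [seq k <- iota 0 m | (a <= k < b)%N] = iota a (b - a).
Proof.
move=> bm; apply: (irr_sorted_eq ltn_trans ltnn).
- exact/(sorted_filter ltn_trans)/iota_ltn_sorted.
- exact: iota_ltn_sorted.
by move=> k; rewrite mem_filter !mem_iota; lia.
Qed.

(** * Cohomology of [O(d)] and the contribution of [F_n] *)

Section Coefficients.
Variable R : realType.

(** The matrix has one column with entries -1 or 1, so its rank is 1 as soon as the monomial is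
    regular on some chart. *)
Lemma rank_cech (d a : int) : \rank (cech_diff R d a) = ((a <= d) || (0 <= a))%R :> nat.
Proof.
case: (boolP ((a <= d) || (0 <= a))%R) => [h|/norP[h1 h2]].
  apply/eqP; rewrite eqn_leq rank_leq_col lt0n mxrank_eq0.
  apply/eqP => /matrixP e; move: h e; rewrite /cech_diff.
  case: (a <= d)%R => /= [_ e|h e].
    have := e (lshift _ ord0) ord0; rewrite col_mxEu !mxE => /eqP.
    by rewrite oppr_eq0 oner_eq0.
  move: e; rewrite h => e; have := e (rshift _ ord0) ord0.
  by rewrite col_mxEd !mxE => /eqP; rewrite oner_eq0.
apply/eqP; rewrite -leqn0; apply: leq_trans (rank_leq_row _) _.
by rewrite (negbTE h1) (negbTE h2).
Qed.

Lemma h0E (d a : int) : h0 R d a = ((0 <= a) && (a <= d))%R :> nat.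
Proof. by rewrite /h0 mxrank_ker rank_cech; case: (a <= d)%R; case: (0 <= a)%R. Qed.

Lemma h1E (d a : int) : h1 R d a = ((d < a) && (a < 0))%R :> nat.
Proof.
rewrite /h1 mxrank_coker rank_cech !ltNge.
by case: (a <= d)%R; case: (0 <= a)%R.
Qed.

Lemma coh_weightsE (h : int -> int -> nat) (P : pred int) (d : int) :
  (forall a, h d a = P a) ->
  coh_weights h d = [seq (- a, 0) | a <- degrees d & P a].
Proof.
move=> hP; rewrite /coh_weights; elim: (degrees d) => //= a s ->.
by rewrite hP; case: (P a).
Qed.

Lemma H0_nat n : coh_weights (h0 R) n%:Z = [seq (- k%:Z, 0) | k <- iota 0 n.+1].
Proof.
rewrite (coh_weightsE (h0E n%:Z)) /degrees absz_nat filter_map -map_comp.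
(* The index [k] of [degrees] stands for [a = k - n], so [0 <= a <= n] selects the window from [n]
   to [2n]. *)
rewrite (_ : [seq k <- _ | _] = iota n n.+1).
  rewrite -[n in iota n]addn0 iotaDl -map_comp; apply: eq_map => k /=.
  by rewrite PoszD addrAC subrr add0r.
have -> : n.+1 = ((2 * n).+1 - n)%N by lia.
rewrite -(@filter_iota_interval (2 * n).+1) //.
by apply: eq_in_filter => k; rewrite mem_iota /=; lia.
Qed.

Lemma H1_nat n : coh_weights (h1 R) n%:Z = [::].
Proof.
rewrite (coh_weightsE (h1E n%:Z)) (eq_filter (a2 := pred0)) ?filter_pred0 //.
by move=> a /=; lia.
Qed.

Lemma H0_opp n : (0 < n)%N -> coh_weights (h0 R) (- n%:Z) = [::].
Proof.
move=> n0; rewrite (coh_weightsE (h0E _)) (eq_filter (a2 := pred0)) ?filter_pred0 //.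
by move=> a /=; lia.
Qed.

Lemma H1_opp n : coh_weights (h1 R) (- n%:Z) =
  [seq (n%:Z - k%:Z, 0) | k <- iota 1 n.-1].
Proof.
rewrite (coh_weightsE (h1E _)) /degrees abszN absz_nat filter_map -map_comp.
(* Again [a = k - n]; the strict bounds [- n < a < 0] leave [k] from 1 to [n - 1]. *)
rewrite (_ : [seq k <- _ | _] = iota 1 n.-1).
  by apply: eq_map => k /=; rewrite opprB.
rewrite -subn1 -(@filter_iota_interval (2 * n).+1); last by lia.
by apply: eq_in_filter => k; rewrite mem_iota /=; lia.
Qed.

Lemma assoc_cohE n w : assoc_coh R n w = RGamma R (- w * n%:Z).
Proof.
rewrite /assoc_coh F_weight0 mulr0 /taut_weight mulr0 /vtens_char /tens_char.
by rewrite [LHS]surjective_pairing; congr pair; rewrite -[RHS]map_id;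
  apply: eq_map => -[a b] /=; rewrite !add0r.
Qed.

Lemma section_cohE n :
  section_coh R n = ([seq (- k%:Z, 1) | k <- iota 0 n.+1], [::]).
Proof.
rewrite /section_coh assoc_cohE opprK mul1r /RGamma H0_nat H1_nat /vtens_char.
rewrite /tens_char /= -map_comp; congr (_ :: _, _).
by apply: eq_map => k /=; rewrite add0r addr0.
Qed.

(** The term [k = 0] of the sections and the adjoint term have [q]-weight 0, so both drop out of the
    moving part. *)
Lemma NvirE n : Nvir R n = ([seq (- k%:Z, 1) | k <- iota 1 n], [::]).
Proof.
rewrite /Nvir /Tvir section_cohE assoc_cohE oppr0 mul0r /RGamma.
rewrite H0_nat H1_nat /= cats0; congr pair.
apply/all_filterP/allP => w /mapP[k]; rewrite mem_iota => k1 ->.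
by rewrite /=; lia.
Qed.

Lemma vtr_lambda_dualE n :
  vtr_lambda_dual (Nvir R n) = \prod_(1 <= k < n.+1) (1 - lamK^-1 * qK ^+ k).
Proof.
rewrite NvirE /vtr_lambda_dual !tr_lambdaE big_nil divr1 !big_map.
rewrite /index_iota subSS subn0; apply: eq_bigr => k _.
by rewrite /wtK /= opprK exprN1 mulrC.
Qed.

Lemma tr_OvirE n : tr_Ovir R n = 1.
Proof. by rewrite /tr_Ovir section_cohE tr_lambdaE big_nil. Qed.

Lemma sum_nat_bin2 n : (\sum_(0 <= k < n) k)%N = ((n * (n - 1)) %/ 2)%N.
Proof. by rewrite bin2_sum bin2 subn1 divn2. Qed.

(** The weights [n - 1, ..., 1] add up to [n (n - 1) / 2]; reversing the product matches the
    standard sum. *)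
Lemma tr_det_H1_opp n :
  tr_det (coh_weights (h1 R) (- n%:Z)) = qK ^+ ((n * (n - 1)) %/ 2).
Proof.
rewrite /tr_det H1_opp big_map -sum_nat_bin2.
case: n => [|n]; first by rewrite !big_geq //= big_nil.
rewrite expr_sum big_ltn // mul1r.
transitivity (\prod_(1 <= k < n.+1) qK ^+ (n.+1 - k)).
  rewrite /index_iota subn1; apply: eq_big_seq => k; rewrite mem_iota => kn.
  by rewrite /wtK /= expr0z mulr1 subzn //; lia.
rewrite big_nat_rev /=; apply: eq_big_nat => k kn.
by congr (_ ^+ _); lia.
Qed.

Lemma tr_det_H0_nat n :
  tr_det (coh_weights (h0 R) n%:Z) = qK ^- ((n * (n + 1)) %/ 2).
Proof.
(* Rewriting [n (n + 1)] as [(n + 1) ((n + 1) - 1)] lets [sum_nat_bin2] apply to the [n + 1]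
   weights. *)
rewrite /tr_det H0_nat big_map mulnC -[X in (_ * X)%N](addnK 1%N) addn1 -sum_nat_bin2.
rewrite expr_sum /index_iota subn0 -prodfV; apply: eq_bigr => k _.
by rewrite /wtK /= expr0z mulr1 exprnN.
Qed.

(** Only [H^1(O(-n))] contributes, inversely, to the determinant; the exponent [- l] cancels this
    sign. The pairing twist is 1 because [taut_weight] is 0. *)
Lemma I_function_St l :
  I_function R St l =
       one_plus (fun n : nat =>
         qK ^ (((n * (n - 1)) %/ 2)%N%:Z * l) /
           \prod_(1 <= k < n.+1) (1 - lamK^-1 * qK ^+ k)).
Proof.
apply/funext => -[//|n]; rewrite /I_function /one_plus /I_coef.
rewrite tr_OvirE vtr_lambda_dualE /tr_level /St big_seq1 assoc_cohE mulN1r.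
rewrite /RGamma /vtr_det /= H0_opp // tr_det_H1_opp [tr_det [::]]big_nil mul1r.
rewrite /phi_lower /phi_upper /det_on_X big_seq1 /wtK /taut_weight !mulr0.
rewrite expr0z mulr1 exp1rz !mul1r mulr1 exprnN exprz_exp.
by rewrite mulrNN.
Qed.

(** Here [H^0(O(n))] contributes, with determinant [q^(- n (n + 1) / 2)]; again [- l] cancels the
    sign. *)
Lemma I_function_St_dual l :
  I_function R St_dual l =
       one_plus (fun n : nat =>
         qK ^ (((n * (n + 1)) %/ 2)%N%:Z * l) /
           \prod_(1 <= k < n.+1) (1 - lamK^-1 * qK ^+ k)).
Proof.
apply/funext => -[//|n]; rewrite /I_function /one_plus /I_coef.
rewrite tr_OvirE vtr_lambda_dualE /tr_level /St_dual big_seq1 assoc_cohE opprK mul1r.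
rewrite /RGamma /vtr_det /= H1_nat tr_det_H0_nat [tr_det [::]]big_nil divr1.
rewrite /phi_lower /phi_upper /det_on_X big_seq1 /wtK /taut_weight !mulr0.
rewrite expr0z mulr1 exp1rz !mul1r mulr1 exprnN exprz_exp.
by rewrite mulrNN mul1n.
Qed.

End Coefficients.

(** * Specializations *)

Import numFieldNormedType.Exports.

(** * Convergence of [q]-series *)

Section Convergence.
Local Open Scope classical_set_scope.
Variable R : realType.
Local Notation C := (complex R).

Lemma ratio_test_cvg (a c : nat -> R) :
  (forall n, 0 <= a n) -> (forall n, a n.+1 <= a n * c n) ->
  c n @[n --> \oo] --> 0 -> cvgn (series a).
Proof.
move=> a0 ac /cvgrPdist_le/(_ (2^-1)) c0.
have [//|N _ cN] := c0 _.
(* [K] dominates [a n * 2 ^+ n] for [n <= N]; from [N] on the ratio is at most 1/2, so [K / 2^n]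
   bounds every term. *)
pose K := \sum_(k < N.+1) a k * 2 ^+ k.
have aK n : a n <= geometric K 2^-1 n.
  rewrite /geometric /=; elim: n => [|n IH].
    rewrite expr0 mulr1 /K big_ord_recl expr0 mulr1 lerDl.
    by apply: sumr_ge0 => i _; rewrite mulr_ge0 ?exprn_ge0.
  have [nN|Nn] := leqP n.+1 N.
    rewrite exprVn ler_pdivlMr ?exprn_gt0 //.
    have nN' : (n.+1 < N.+1)%N by [].
    rewrite /K (bigD1 (Ordinal nN')) //= lerDl.
    by apply: sumr_ge0 => i _; rewrite mulr_ge0 ?exprn_ge0.
  apply: le_trans (ac n) _; rewrite exprSr mulrA.
  apply: le_trans (_ : a n * 2^-1 <= _); last by rewrite ler_wpM2r.
  rewrite ler_wpM2l //; have := cN n Nn; rewrite /= sub0r normrN.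
  exact/le_trans/ler_norm.
apply: (series_le_cvg a0 _ aK) => //.
  by move=> n; apply: le_trans (a0 n) (aK n).
apply: is_cvg_geometric_series; rewrite ger0_norm //; lra.
Qed.

(** Real and imaginary parts converge absolutely by comparison with [b], and their sums are
    recombined. *)
Lemma complex_series_cvg (u : nat -> C) (b : nat -> R) :
  (forall n, Normc.normc (u n) <= b n) -> cvgn (series b) -> exists S : C, has_sum u S.
Proof.
move=> ub bcvg.
have b0 n : 0 <= b n by apply: le_trans (ub n); case: (u n) => x y; apply: sqrtr_ge0.
have real_cvg (v : nat -> R) : (forall n, `|v n| <= Normc.normc (u n)) -> cvgn (series v).
  move=> vu; apply: normed_cvg; apply: series_le_cvg bcvg => n //=.
  exact: le_trans (vu n) (ub n).
have /cvg_ex[x xP] : cvgn (series (fun n => complex.Re (u n))).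
  apply: (real_cvg (fun n => complex.Re (u n))) => n; case: (u n) => v w /=.
  by rewrite -sqrtr_sqr ler_wsqrtr // lerDl sqr_ge0.
have /cvg_ex[y yP] : cvgn (series (fun n => complex.Im (u n))).
  apply: (real_cvg (fun n => complex.Im (u n))) => n; case: (u n) => v w /=.
  by rewrite -sqrtr_sqr ler_wsqrtr // lerDr sqr_ge0.
exists (x +i* y)%C; rewrite /has_sum.
apply/cvgrPdist_lt => eps eps0.
(* A positive element of [C] is real, so the estimate can be made in [R]. *)
have [e eE] : exists e, eps = (e%:C)%C by apply/complex_realP/gtr0_real.
have {}eps0 : 0 < e by rewrite -ltcR -eE.
have e2 : 0 < e / 2 by rewrite divr_gt0.
move/cvgrPdist_lt/(_ _ e2) : xP => xP.
move/cvgrPdist_lt/(_ _ e2) : yP => yP.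
near=> n.
have xn : `|x - series (fun n => complex.Re (u n)) n| < e / 2 by near: n.
have yn : `|y - series (fun n => complex.Im (u n)) n| < e / 2 by near: n.
have -> : series u n = (series (fun n => complex.Re (u n)) n +i* series (fun n => complex.Im (u n)) n)%C.
  rewrite /series /=; elim/big_rec3: _ => // i z1 z2 z3 _ ->.
  by case: (u i).
rewrite eE.
have -> : (x +i* y - (series (fun n => complex.Re (u n)) n +i* series (fun n => complex.Im (u n)) n))%C
  = ((x - series (fun n => complex.Re (u n)) n)%:C + 'i * (y - series (fun n => complex.Im (u n)) n)%:C)%C.
  by apply/eqP; rewrite eq_complex /=; apply/andP; split; apply/eqP; ring.
apply: le_lt_trans (ler_normD _ _) _; rewrite normrM.
rewrite !normc_def /= !expr0n /= !addr0 add0r expr1n sqrtr1 mul1r !sqrtr_sqr.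
by rewrite -rmorphD ltcR; lra.
Unshelve. all: by end_near. Qed.


Lemma normCE (z : C) : `|z| = (Normc.normc z)%:C%C.
Proof. by []. Qed.

(** With [r = |q|], consecutive terms have ratio at most [r^n / (1 - r)], which tends to 0. *)
Lemma q_series_cvg (q : C) (E : nat -> nat) (d : nat -> C) :
  `|q| < 1 -> (forall n, (E n + n <= E n.+1)%N) ->
  (forall k, (0 < k)%N -> `|d k - 1| <= `|q|) ->
  exists S, has_sum (fun n => q ^+ E n / \prod_(1 <= k < n.+1) d k) S.
Proof.
rewrite normCE; set r := Normc.normc q => r1 hE hd.
have {}r1 : r < 1 by rewrite -ltcR.
have N0 (z : C) : 0 <= Normc.normc z by case: z => x y; apply: sqrtr_ge0.
pose u n := q ^+ E n / \prod_(1 <= k < n.+1) d k.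
have dk k : (0 < k)%N -> 1 - r <= Normc.normc (d k).
  move=> k0; have := hd k k0; rewrite normCE lecR => dr.
  have := le_normcD (d k) (1 - d k).
  by rewrite addrC subrK Normc.normc1 -(normcN (1 - d k)) opprB; lra.
have uS n : Normc.normc (u n.+1) <= Normc.normc (u n) * ((1 - r)^-1 * r ^+ n).
  have -> : u n.+1 = u n * (q ^+ (E n.+1 - E n) / d n.+1).
    rewrite /u big_nat_recr //= invfM mulrACA -exprD subnKC //.
    exact: leq_trans (leq_addr _ _) (hE n).
  have qX m : Normc.normc (q ^+ m) = r ^+ m.
    by apply: complexI; rewrite -normCE normrX rmorphXn.
  rewrite Normc.normcM ler_wpM2l // Normc.normcM Normc.normcV qX mulrC.
  apply: ler_pM; rewrite ?invr_ge0 ?exprn_ge0 ?N0 //.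
    by rewrite lef_pV2 ?dk // posrE; [have := dk n.+1 isT|]; lra.
  rewrite ler_wiXn2l ?N0 ?ltW // leq_subRL ?hE //.
  exact: leq_trans (leq_addr _ _) (hE n).
apply: (complex_series_cvg (b := fun n => Normc.normc (u n))) => //.
apply: (ratio_test_cvg _ uS) => //.
by apply: cvg_geometric; rewrite ger0_norm // N0.
Qed.

End Convergence.

(** * Evaluation of the coefficients and the seven specializations *)

Section Specialization.
Variable R : realType.
Local Notation C := (complex R).

(** This is [eval_ql] as a composite of ring morphisms, from which its morphism structure is
    inferred. *)
Definition ev_ql (q0 lam0 : C) : {poly {poly int}} -> C :=
  horner_eval q0 \o map_poly (horner_eval lam0 \o map_poly intr).

Lemma eval_qlE q0 lam0 p : eval_ql q0 lam0 p = ev_ql q0 lam0 p.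
Proof. by []. Qed.

HB.instance Definition _ q0 lam0 := GRing.RMorphism.on (ev_ql q0 lam0).

Lemma specializes_q_product (q0 lam0 : C) n e :
  lam0 != 0 -> (forall k, (0 < k)%N -> 1 - lam0^-1 * q0 ^+ k != 0) ->
  specializes q0 lam0 (qK ^+ e / \prod_(1 <= k < n.+1) (1 - lamK^-1 * qK ^+ k))
    (q0 ^+ e / \prod_(1 <= k < n.+1) (1 - lam0^-1 * q0 ^+ k)).
Proof.
move=> l0 d0.
(* Stated over any field because it is needed both in [Kloc] and in [C]. *)
have prodE (F : fieldType) (l q : F) : l != 0 ->
    \prod_(1 <= k < n.+1) (l - q ^+ k) =
    l ^+ n * \prod_(1 <= k < n.+1) (1 - l^-1 * q ^+ k).
  move=> ln0; rewrite -[n in l ^+ n](subn1 n.+1) -prodr_const_nat -big_split /=.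
  by apply: eq_bigr => k _; rewrite mulrBr mulr1 mulrA mulfV // mul1r.
have evX : ev_ql q0 lam0 'X = q0.
  by rewrite /ev_ql /= map_polyX /horner_eval hornerX.
have evL : ev_ql q0 lam0 'X%:P = lam0.
  by rewrite /ev_ql /= map_polyC /= /horner_eval map_polyX hornerX hornerC.
have evY : ev_ql q0 lam0 (\prod_(1 <= k < n.+1) ('X%:P - 'X^k)) =
    lam0 ^+ n * \prod_(1 <= k < n.+1) (1 - lam0^-1 * q0 ^+ k).
  rewrite rmorph_prod -prodE //; apply: eq_bigr => k _.
  by rewrite rmorphB rmorphXn /= evX evL.
(* Multiplying numerator and denominator by [lam^n] removes the inverses of [lam]. *)
exists ('X%:P ^+ n * 'X^e), (\prod_(1 <= k < n.+1) ('X%:P - 'X^k)).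
rewrite !eval_qlE evY; split.
- rewrite mulf_neq0 ?expf_neq0 // prodf_seq_neq0.
  by apply/allP => k; rewrite mem_index_iota => /andP[k0 _]; rewrite d0.
- have -> : tofrac (\prod_(1 <= k < n.+1) ('X%:P - 'X^k)) =
      lamK ^+ n * \prod_(1 <= k < n.+1) (1 - lamK^-1 * qK ^+ k).
    rewrite rmorph_prod -prodE ?lamK_neq0 //; apply: eq_bigr => k _.
    by rewrite rmorphB rmorphXn.
  by rewrite rmorphM !rmorphXn /= -mulf_div divff ?mul1r // expf_neq0 ?lamK_neq0.
by rewrite rmorphM !rmorphXn /= evX evL -mulf_div divff ?mul1r // expf_neq0.
Qed.

Lemma specializes_to_q_series (I : nat -> Kloc) (e E : nat -> nat)
    (q0 lam0 Q0 q : C) (d : nat -> C) :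
  I = one_plus (fun n => qK ^+ e n / \prod_(1 <= k < n.+1) (1 - lamK^-1 * qK ^+ k)) ->
  e 0%N = 0%N -> E 0%N = 0%N ->
  lam0 != 0 -> `|q| < 1 ->
  (forall n, q0 ^+ e n * Q0 ^+ n = q ^+ E n) ->
  (forall n, (E n + n <= E n.+1)%N) ->
  (forall k, (0 < k)%N -> 1 - lam0^-1 * q0 ^+ k = d k) ->
  (forall k, (0 < k)%N -> `|d k - 1| <= `|q|) ->
  specializes_to I q0 lam0 Q0 (fun n => q ^+ E n / \prod_(1 <= k < n.+1) d k).
Proof.
move=> IE e0 E0 l0 q1 qE EE dE d1.
(* If [d k = 0] then [|d k - 1| = 1], contradicting [|q| < 1]. *)
have dn0 k : (0 < k)%N -> d k != 0.
  move=> k0; apply: contraTneq (d1 k k0) => ->.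
  by rewrite sub0r normrN normr1 lt_geF.
have v1 : one_plus (fun n => q ^+ E n / \prod_(1 <= k < n.+1) d k) =
    (fun n => q ^+ E n / \prod_(1 <= k < n.+1) d k).
  by apply/funext => -[|n] //=; rewrite E0 big_geq // divr1.
have [S SP] := q_series_cvg q1 EE d1.
exists S; rewrite v1; split=> //.
exists (fun n => q0 ^+ e n / \prod_(1 <= k < n.+1) (1 - lam0^-1 * q0 ^+ k)); split.
  move=> n; rewrite IE.
  suff -> : one_plus (fun n => qK ^+ e n / \prod_(1 <= k < n.+1) (1 - lamK^-1 * qK ^+ k)) n
    = qK ^+ e n / \prod_(1 <= k < n.+1) (1 - lamK^-1 * qK ^+ k).
    by apply: specializes_q_product => // k k0; rewrite dE ?dn0.
  by case: n => //=; rewrite e0 big_geq // divr1.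
suff -> : (fun n => q0 ^+ e n / \prod_(1 <= k < n.+1) (1 - lam0^-1 * q0 ^+ k) * Q0 ^+ n) =
  (fun n => q ^+ E n / \prod_(1 <= k < n.+1) d k) by [].
apply/funext => n; rewrite mulrAC qE; congr (_ / _).
by apply: eq_big_nat => k /andP[k0 _]; rewrite dE.
Qed.

Lemma norm_exp_le (q : C) b : `|q| < 1 -> (0 < b)%N -> `|q ^+ b| <= `|q|.
Proof.
move=> q1 b0; rewrite normrX -[leRHS]expr1.
by rewrite ler_wiXn2l // ltW.
Qed.

Lemma double_half_pronic n : (n * (n - 1) %/ 2 * 2 = n * (n - 1))%N.
Proof. by rewrite divnK // dvdn2 oddM; case: n => // n; rewrite subn1 /= andNb. Qed.

Lemma double_half_pronicS n : (n * (n + 1) %/ 2 * 2 = n * (n + 1))%N.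
Proof. by rewrite divnK // dvdn2 oddM addn1 /= andbN. Qed.

Lemma I_function_St_nat (l : nat) : I_function R St l%:Z =
  one_plus (fun n => qK ^+ (n * (n - 1) %/ 2 * l) /
    \prod_(1 <= k < n.+1) (1 - lamK^-1 * qK ^+ k)).
Proof. exact: I_function_St. Qed.

Lemma I_function_St_dual_nat (l : nat) : I_function R St_dual l%:Z =
  one_plus (fun n => qK ^+ (n * (n + 1) %/ 2 * l) /
    \prod_(1 <= k < n.+1) (1 - lamK^-1 * qK ^+ k)).
Proof. exact: I_function_St_dual. Qed.

(** Base [q^2] with [lam = q] or [- q] produces the odd exponents; [0 < k] keeps the subtraction
    from truncating. *)
Lemma invf_expr_double (q : C) k : q != 0 -> (0 < k)%N ->
  q^-1 * (q ^+ 2) ^+ k = q ^+ (2 * k - 1).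
Proof.
move=> q0 k0; apply: (mulfI q0); rewrite mulVKf // -exprM -exprS.
by congr (_ ^+ _); lia.
Qed.

End Specialization.

Theorem proposition1p3 (R : realType) :
  (exists ch : forall r, cocycle R r -> Kloc, K_iso ch) /\
  (forall l : int,
     I_function R St l =
       one_plus (fun n : nat =>
         qK ^ (((n * (n - 1)) %/ 2)%N%:Z * l) /
           \prod_(1 <= k < n.+1) (1 - lamK^-1 * qK ^+ k)) /\
     I_function R St_dual l =
       one_plus (fun n : nat =>
         qK ^ (((n * (n + 1)) %/ 2)%N%:Z * l) /
           \prod_(1 <= k < n.+1) (1 - lamK^-1 * qK ^+ k))) /\
  (forall q : complex R, 0 < `|q| < 1 ->
     [/\ specializes_to (I_function R St 1) (q ^+ 2) (- 1) q
           (fun n => q ^+ (n ^ 2) /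
              \prod_(1 <= k < n.+1) (1 + q ^+ (2 * k))),
         specializes_to (I_function R St 1) (q ^+ 2) q q
           (fun n => q ^+ (n ^ 2) /
              \prod_(1 <= k < n.+1) (1 - q ^+ (2 * k - 1)))
       & specializes_to (I_function R St 1) (q ^+ 2) (- q) 1
           (fun n => q ^+ (n * (n - 1)) /
              \prod_(1 <= k < n.+1) (1 + q ^+ (2 * k - 1)))] /\
     [/\ specializes_to (I_function R St 2) q (- 1) q
           (fun n => q ^+ (n ^ 2) /
              \prod_(1 <= k < n.+1) (1 + q ^+ k)),
         specializes_to (I_function R St 2) (q ^+ 2) q (q ^+ 2)
           (fun n => q ^+ (2 * n ^ 2) /
              \prod_(1 <= k < n.+1) (1 - q ^+ (2 * k - 1))),
         specializes_to (I_function R St_dual 2) q (- 1) 1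
           (fun n => q ^+ (n * (n + 1)) /
              \prod_(1 <= k < n.+1) (1 + q ^+ k))
       & specializes_to (I_function R St_dual 2) (q ^+ 2) q 1
           (fun n => q ^+ (2 * n ^ 2 + 2 * n) /
              \prod_(1 <= k < n.+1) (1 - q ^+ (2 * k - 1)))]).
Proof.
split; first exact: exists_K_iso.
split; first by move=> l; split; [exact: I_function_St|exact: I_function_St_dual].
move=> q /andP[]; rewrite normr_gt0 => q0 q1.
have qN0 : - q != 0 by rewrite oppr_eq0.
have m1 : (-1 : complex R) != 0 by rewrite oppr_eq0 oner_neq0.
have le1 b : (0 < b)%N -> `|1 + q ^+ b - 1| <= `|q|.
  by move=> b0; rewrite addrAC subrr add0r norm_exp_le.
have le2 b : (0 < b)%N -> `|1 - q ^+ b - 1| <= `|q|.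
  by move=> b0; rewrite addrAC subrr add0r normrN norm_exp_le.
split; split.
- apply: (specializes_to_q_series (I_function_St_nat R 1)) => //.
  (* Level 1 at [q^2] gives [n (n - 1)], and [Q = q] adds [n], for a total of [n^2]. *)
  + by move=> n; rewrite -exprM -exprD; congr (_ ^+ _); have := double_half_pronic n; nia.
  + by move=> n; nia.
  + by move=> k k0; rewrite invrN1 mulN1r opprK -exprM.
  + by move=> k k0; apply: le1; lia.
- apply: (specializes_to_q_series (I_function_St_nat R 1)) => //.
  + by move=> n; rewrite -exprM -exprD; congr (_ ^+ _); have := double_half_pronic n; nia.
  + by move=> n; nia.
  + by move=> k k0; rewrite invf_expr_double.
  + by move=> k k0; apply: le2; lia.
- apply: (specializes_to_q_series (I_function_St_nat R 1)) => //.
  + by move=> n; rewrite expr1n mulr1 -exprM; congr (_ ^+ _); have := double_half_pronic n; lia.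
  + by move=> n; nia.
  + by move=> k k0; rewrite invrN mulNr opprK invf_expr_double.
  + by move=> k k0; apply: le1; lia.
- apply: (specializes_to_q_series (I_function_St_nat R 2)) => //.
  + by move=> n; rewrite -exprD double_half_pronic; congr (_ ^+ _); nia.
  + by move=> n; nia.
  + by move=> k k0; rewrite invrN1 mulN1r opprK.
- apply: (specializes_to_q_series (I_function_St_nat R 2)) => //.
  (* Level 2 at [q^2] gives [2 n (n - 1)], and [Q = q^2] adds [2 n]. *)
  + by move=> n; rewrite -!exprM -exprD double_half_pronic; congr (_ ^+ _); nia.
  + by move=> n; nia.
  + by move=> k k0; rewrite invf_expr_double.
  + by move=> k k0; apply: le2; lia.
- apply: (specializes_to_q_series (I_function_St_dual_nat R 2)) => //.
  + by move=> n; rewrite expr1n mulr1 double_half_pronicS.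
  + by move=> n; nia.
  + by move=> k k0; rewrite invrN1 mulN1r opprK.
apply: (specializes_to_q_series (I_function_St_dual_nat R 2)) => //.
+ by move=> n; rewrite expr1n mulr1 -exprM double_half_pronicS; congr (_ ^+ _); nia.
+ by move=> n; nia.
+ by move=> k k0; rewrite invf_expr_double.
+ by move=> k k0; apply: le2; lia.
Qed.
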